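(* Let $A=\{a_1,\ldots,a_m\}$ and let $\epsilon^{\mathcal{P}}:FIM_A\to\prod_{i=1}^m FIM_{A_i}$ be the eraser homomorphism induced by the canonical presentation $\mathcal{P}=\mathrm{Inv}\langle A\mid\emptyset\rangle$. Let $w\in\widetilde{A}^*$. Then $w\rho_A\in K(\ker\epsilon^{\mathcal{P}})$ if and only if $w\sigma_A$ is a fragile word.
   Context: For a set $B$ put $\widetilde{B}=B\cup B^{-1}$, with $B^{-1}$ a set of formal inverses, and extend $^{-1}$ to an involution of the free monoid $\widetilde{B}^*$ by $1^{-1}=1$, $(uv)^{-1}=v^{-1}u^{-1}$. Let $\rho_B$ be the congruence on $\widetilde{B}^*$ generated by all pairs $(ww^{-1}w,w)$ and $(uu^{-1}vv^{-1},vv^{-1}uu^{-1})$ with $u,v,w\in\widetilde{B}^*$. $FIM_B=\widetilde{B}^*/\rho_B$ is the free inverse monoid on $B$; $w\rho_B$ denotes the class of $w$. $\sigma_A$ is the canonical free group congruence on $\widetilde{A}^*$, so $FG_A=\widetilde{A}^*/\sigma_A$ is the free group on $A$ and $w\sigma_A$ is the element of $FG_A$ represented by $w$. For $A=\{a_1,\ldots,a_m\}$ let $A_i=A\setminus\{a_i\}$ and let $\theta_i:\widetilde{A}^*\to\widetilde{A_i}^*$ be the homomorphism deleting the letters $a_i,a_i^{-1}$ and fixing the others. Then $\epsilon^{\mathcal{P}}$ is the (well-defined) homomorphism $w\rho_A\mapsto((w\theta_1)\rho_{A_1},\ldots,(w\theta_m)\rho_{A_m})$. Its kernel is the congruence $\ker\epsilon^{\mathcal{P}}=\{(x,y)\in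 FIM_A\times FIM_A\mid x\epsilon^{\mathcal{P}}=y\epsilon^{\mathcal{P}}\}$. For a congruence $\tau$ on an inverse monoid $N$, $K(\tau)=\{u\in N\mid u\,\tau\,u^2\}$. An element of $FG_A$ is called fragile if for every $a\in A$ it lies in the kernel of the canonical projection $FG_A\to FG_{A\setminus\{a\}}$ (which sends $a$ to $1$ and fixes the other generators). The identity element counts as fragile. *)

(* Defs.v *)
From HB Require Import structures.
From mathcomp Require Import all_boot.
From mathcomp Require Import boolp.

Set Implicit Arguments.
Unset Strict Implicit.
Unset Printing Implicit Defensive.

Local Open Scope group_scope.
Local Open Scope quotient_scope.

Section MonoidPresentation.
Variables (T : choiceType) (R : seq T -> seq T -> Prop).

Inductive cong_gen : seq T -> seq T -> Prop :=
| cong_base u v : R u v -> cong_gen u v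
| cong_refl u : cong_gen u u
| cong_sym u v : cong_gen u v -> cong_gen v u
| cong_trans u v w : cong_gen u v -> cong_gen v w -> cong_gen u w
| cong_cat u u' v v' :
    cong_gen u u' -> cong_gen v v' -> cong_gen (u ++ v) (u' ++ v').

(* Classical decidability makes the congruence a boolean relation, as required
   by [{eq_quot _}]. *)
Definition cong_genb : rel (seq T) := fun u v => `[< cong_gen u v >].

Lemma cong_genb_refl : reflexive cong_genb.
Proof. by move=> u; apply/asboolP/cong_refl. Qed.

Lemma cong_genb_sym : symmetric cong_genb.
Proof. by move=> u v; apply/asboolP/asboolP; apply: cong_sym. Qed.

Lemma cong_genb_trans : transitive cong_genb.
Proof.
by move=> v u w /asboolP uv /asboolP vw; apply/asboolP/(cong_trans uv vw).
Qed.

Canonical cong_gen_equiv :=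
  EquivRel cong_genb cong_genb_refl cong_genb_sym cong_genb_trans.

Definition presented := {eq_quot cong_genb}.

HB.instance Definition _ := Choice.on presented.
HB.instance Definition _ := EqQuotient.on presented.

Lemma presentedP u v :
  \pi_presented u = \pi_presented v <-> cong_gen u v.
Proof.
split; first by move/eqP; rewrite eqmodE => /asboolP.
by move=> uv; apply/eqP; rewrite eqmodE; apply/asboolP.
Qed.

Definition presented_mul (x y : presented) : presented :=
  \pi_presented (repr x ++ repr y).

Lemma presented_mul_pi u v :
  presented_mul (\pi_presented u) (\pi_presented v) = \pi_presented (u ++ v).
Proof. by apply/presentedP; apply: cong_cat; apply/presentedP; rewrite reprK. Qed.

Lemma presented_mulA : associative presented_mul.
Proof.
elim/quotW=> u; elim/quotW=> v; elim/quotW=> w.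
by rewrite (presented_mul_pi u v) (presented_mul_pi v w) !presented_mul_pi catA.
Qed.

Lemma presented_mul1 : left_id (\pi_presented [::]) presented_mul.
Proof. by move=> x; rewrite -[x]reprK presented_mul_pi. Qed.

Lemma presented_mulr1 : right_id (\pi_presented [::]) presented_mul.
Proof. by move=> x; rewrite -[x]reprK presented_mul_pi cats0. Qed.

HB.instance Definition _ := isMonoid.Build presented
  presented_mulA presented_mul1 presented_mulr1.

Lemma presented_piM u v :
  \pi_presented u * \pi_presented v = \pi_presented (u ++ v).
Proof. exact: presented_mul_pi. Qed.

Lemma presented_pi1 : \pi_presented [::] = 1.
Proof. by []. Qed.

End MonoidPresentation.

Section MonoidPresentationLift.
Variables (T U : choiceType).
Variables (R : seq T -> seq T -> Prop) (S : seq U -> seq U -> Prop).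
Variable f : seq T -> seq U.

Definition presented_lift (x : presented R) : presented S :=
  \pi_(presented S) (f (repr x)).

Lemma presented_lift_pi :
  (forall u v, cong_gen R u v -> cong_gen S (f u) (f v)) ->
  forall u, presented_lift (\pi_(presented R) u) = \pi_(presented S) (f u).
Proof.
by move=> fP u; apply/presentedP/fP/presentedP; rewrite reprK.
Qed.

End MonoidPresentationLift.

(* The alphabet B \cup B^{-1}: [inl b] is the letter b, [inr b] its formal
   inverse. *)
Definition letter (B : Type) := (B + B)%type.
Definition word (B : Type) := seq (letter B).

Definition linv (B : Type) (x : letter B) : letter B :=
  match x with inl b => inr b | inr b => inl b end.

Definition winv (B : Type) (w : word B) : word B := rev (map (@linv B) w).

Lemma linvK B : involutive (@linv B).
Proof. by case. Qed.

Lemma winvK B : involutive (@winv B).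
Proof.
by move=> w; rewrite /winv map_rev revK (mapK (@linvK B)).
Qed.

Lemma winv_cat B (u v : word B) : winv (u ++ v) = winv v ++ winv u.
Proof. by rewrite /winv map_cat rev_cat. Qed.

Section FreeInverseMonoid.
Variable B : choiceType.

Inductive fim_rel : word B -> word B -> Prop :=
| fim_regular w : fim_rel (w ++ winv w ++ w) w
| fim_commute u v :
    fim_rel (u ++ winv u ++ v ++ winv v) (v ++ winv v ++ u ++ winv u).

Definition rho : word B -> word B -> Prop := cong_gen fim_rel.

Definition FIM := presented fim_rel.

HB.instance Definition _ := Monoid.on FIM.
HB.instance Definition _ := EqQuotient.on FIM.

Lemma rho_winv u v : rho u v -> rho (winv u) (winv v).
Proof.
elim=> [{}u {}v [w|x y]|w|{}u {}v _|{}u {}v w _ uv _|{}u u' {}v v' _ uu' _ vv'].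
- by rewrite !winv_cat -catA; apply/cong_base/fim_regular.
- by rewrite !winv_cat !winvK -!catA; apply/cong_base/fim_commute.
- exact: cong_refl.
- exact: cong_sym.
- exact: cong_trans.
- by rewrite !winv_cat; apply: cong_cat.
Qed.

Definition fim_inv : FIM -> FIM := @presented_lift _ _ fim_rel fim_rel (@winv B).

Lemma fim_inv_pi w : fim_inv (\pi_FIM w) = \pi_FIM (winv w).
Proof. exact: presented_lift_pi rho_winv w. Qed.

HB.instance Definition _ := hasInv.Build FIM fim_inv.

Lemma fim_invK : involutive (@inv FIM).
Proof.
elim/quotW=> u; rewrite [LHS](_ : _ = fim_inv (fim_inv (\pi_FIM u))) //.
by rewrite (fim_inv_pi u) (fim_inv_pi (winv u)) winvK.
Qed.

Lemma fim_invM : {morph @inv FIM : x y / x * y >-> y * x}.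
Proof.
elim/quotW=> u; elim/quotW=> v; rewrite (presented_piM _ u v).
transitivity (\pi_FIM (winv (u ++ v))); first exact: fim_inv_pi.
rewrite winv_cat -presented_piM; congr (_ * _); symmetry; exact: fim_inv_pi.
Qed.

HB.instance Definition _ := Monoid_isStarMonoid.Build FIM fim_invK fim_invM.

End FreeInverseMonoid.

Section FreeGroup.
Variable B : choiceType.

Inductive fg_rel : word B -> word B -> Prop :=
| fg_cancel (x : letter B) : fg_rel [:: x; linv x] [::].

Definition sigma : word B -> word B -> Prop := cong_gen fg_rel.

Definition FG := presented fg_rel.

HB.instance Definition _ := Monoid.on FG.
HB.instance Definition _ := EqQuotient.on FG.

Lemma sigma_winv u v : sigma u v -> sigma (winv u) (winv v).
Proof.
elim=> [{}u {}v [x]|w|{}u {}v _|{}u {}v w _ uv _|{}u u' {}v v' _ uu' _ vv'].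
- by rewrite /winv /= /rev /= linvK; apply/cong_base/fg_cancel.
- exact: cong_refl.
- exact: cong_sym.
- exact: cong_trans.
- by rewrite !winv_cat; apply: cong_cat.
Qed.

Lemma sigma_cancel w : sigma (w ++ winv w) [::].
Proof.
elim: w => [|x w IHw]; first exact: cong_refl.
rewrite -cat1s winv_cat -catA (catA w).
apply: (@cong_trans _ _ _ ([:: x] ++ [::] ++ winv [:: x])).
  by apply/cong_cat/cong_cat; [exact: cong_refl|exact: IHw|exact: cong_refl].
exact/cong_base/fg_cancel.
Qed.

Definition fg_inv : FG -> FG := @presented_lift _ _ fg_rel fg_rel (@winv B).

Lemma fg_inv_pi w : fg_inv (\pi_FG w) = \pi_FG (winv w).
Proof. exact: presented_lift_pi sigma_winv w. Qed.

HB.instance Definition _ := hasInv.Build FG fg_inv.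

Lemma fg_mulgV : right_inverse 1 (@inv FG) *%g.
Proof.
elim/quotW=> w; transitivity (\pi_FG w * \pi_FG (winv w)).
  by congr (_ * _); exact: fg_inv_pi.
by rewrite presented_piM; exact/presentedP/sigma_cancel.
Qed.

Lemma fg_mulVg : left_inverse 1 (@inv FG) *%g.
Proof.
elim/quotW=> w; transitivity (\pi_FG (winv w) * \pi_FG w).
  by congr (_ * _); exact: fg_inv_pi.
rewrite presented_piM -{2}[w]winvK; exact/presentedP/sigma_cancel.
Qed.

HB.instance Definition _ := Monoid_isGroup.Build FG fg_mulVg fg_mulgV.

End FreeGroup.

Section Eraser.
Variable A : finType.

(* A is indexed by itself: [del a] is the alphabet A_i when a = a_i. *)
Definition del (a : A) : finType := {b : A | b != a}.

Definition erase_letter (a : A) (x : letter A) : option (letter (del a)) :=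
  match x with
  | inl b => omap inl (insub b : option (del a))
  | inr b => omap inr (insub b : option (del a))
  end.

Definition erase (a : A) (w : word A) : word (del a) := pmap (erase_letter a) w.

Lemma erase_cat a u v : erase a (u ++ v) = erase a u ++ erase a v.
Proof. exact: pmap_cat. Qed.

Lemma erase_winv a w : erase a (winv w) = winv (erase a w).
Proof.
elim: w => // x w IHw; rewrite -cat1s winv_cat !erase_cat winv_cat IHw.
by congr (_ ++ _); case: x => b; rewrite /erase /winv /= /rev /=; case: insub.
Qed.

Lemma erase_rho a u v : rho u v -> rho (erase a u) (erase a v).
Proof.
elim=> [{}u {}v [w|x y]|w|{}u {}v _|{}u {}v w _ uv _|{}u u' {}v v' _ uu' _ vv'].
- by rewrite !erase_cat erase_winv; apply/cong_base/fim_regular.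
- by rewrite !erase_cat !erase_winv; apply/cong_base/fim_commute.
- exact: cong_refl.
- exact: cong_sym.
- exact: cong_trans.
- by rewrite !erase_cat; apply: cong_cat.
Qed.

Lemma erase_sigma a u v : sigma u v -> sigma (erase a u) (erase a v).
Proof.
elim=> [{}u {}v [x]|w|{}u {}v _|{}u {}v w _ uv _|{}u u' {}v v' _ uu' _ vv'].
- case: x => b; rewrite /erase /=; case: insub => [c|]; try exact: cong_refl.
    exact/cong_base/(fg_cancel (inl c)).
  exact/cong_base/(fg_cancel (inr c)).
- exact: cong_refl.
- exact: cong_sym.
- exact: cong_trans.
- by rewrite !erase_cat; apply: cong_cat.
Qed.

Definition fim_erase (a : A) : FIM A -> FIM (del a) :=
  @presented_lift _ _ (@fim_rel A) (@fim_rel (del a)) (erase a).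

Lemma fim_erase_pi a w :
  fim_erase a (\pi_(FIM A) w) = \pi_(FIM (del a)) (erase a w).
Proof. exact: presented_lift_pi (@erase_rho a) w. Qed.

Lemma fim_erase_morphism a : monoid_morphism (fim_erase a).
Proof.
split; first exact: fim_erase_pi.
elim/quotW=> u; elim/quotW=> v; rewrite (presented_piM _ u v).
rewrite (fim_erase_pi a (u ++ v)) (fim_erase_pi a u) (fim_erase_pi a v).
by rewrite erase_cat -presented_piM.
Qed.

Definition fg_erase (a : A) : FG A -> FG (del a) :=
  @presented_lift _ _ (@fg_rel A) (@fg_rel (del a)) (erase a).

Lemma fg_erase_pi a w :
  fg_erase a (\pi_(FG A) w) = \pi_(FG (del a)) (erase a w).
Proof. exact: presented_lift_pi (@erase_sigma a) w. Qed.

Lemma fg_erase_morphism a : monoid_morphism (fg_erase a).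
Proof.
split; first exact: fg_erase_pi.
elim/quotW=> u; elim/quotW=> v; rewrite (presented_piM _ u v).
rewrite (fg_erase_pi a (u ++ v)) (fg_erase_pi a u) (fg_erase_pi a v).
by rewrite erase_cat -presented_piM.
Qed.

HB.instance Definition _ a :=
  isUMagmaMorphism.Build (FG A) (FG (del a)) (fg_erase a) (fg_erase_morphism a).

Definition fragile (g : FG A) : Prop := forall a : A, fg_erase a g = 1.

End Eraser.

Section MonoidProduct.
Variables (I : finType) (M : I -> monoidType).

Definition mprod := {dffun forall i : I, M i}.

HB.instance Definition _ := Choice.on mprod.

Definition mprod_mul (x y : mprod) : mprod := [ffun i => x i * y i].
Definition mprod_one : mprod := [ffun i => 1].

Lemma mprod_mulA : associative mprod_mul.
Proof. by move=> x y z; apply/ffunP => i; rewrite !ffunE mulgA. Qed.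

Lemma mprod_mul1 : left_id mprod_one mprod_mul.
Proof. by move=> x; apply/ffunP => i; rewrite !ffunE mul1g. Qed.

Lemma mprod_mulr1 : right_id mprod_one mprod_mul.
Proof. by move=> x; apply/ffunP => i; rewrite !ffunE mulg1. Qed.

HB.instance Definition _ :=
  isMonoid.Build mprod mprod_mulA mprod_mul1 mprod_mulr1.

End MonoidProduct.

Section EraserMorphism.
Variable A : finType.

Definition eraser_cod : monoidType := mprod (fun a : A => FIM (del a)).

Definition eraser (x : FIM A) : eraser_cod :=
  [ffun a => fim_erase a x] : mprod (fun a : A => FIM (del a)).

Lemma eraser_pi w :
  eraser (\pi_(FIM A) w) = [ffun a => \pi_(FIM (del a)) (erase a w)].
Proof. by apply/ffunP => a; rewrite !ffunE; exact: fim_erase_pi. Qed.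

Lemma eraser_morphism : monoid_morphism eraser.
Proof.
split=> [|x y]; apply/ffunP => a; rewrite !ffunE.
  exact: (fim_erase_morphism a).1.
exact: (fim_erase_morphism a).2.
Qed.

HB.instance Definition _ :=
  isUMagmaMorphism.Build (FIM A) eraser_cod eraser eraser_morphism.

End EraserMorphism.

Definition mker (M N : monoidType) (f : UMagmaMorphism.type M N) (x y : M) : Prop :=
  f x = f y.

Definition Kcong (N : monoidType) (tau : N -> N -> Prop) (u : N) : Prop :=
  tau u (u ^+ 2).

(* Main.v *)
(** Since [FIM] and [FG] share the alphabet, everything reduces to showing that
    [u] represents [1] in [FG B] exactly when it is idempotent in [FIM B].  For
    the nontrivial direction, if [r] is the free reduction of [u] then
    [u = u u^-1 r] holds in [FIM B]; when [r] is empty, [u = u u^-1]. *)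
Require Import Defs.
From mathcomp Require Import all_boot.

Local Open Scope quotient_scope.

Set Implicit Arguments.
Unset Strict Implicit.
Unset Printing Implicit Defensive.

Local Open Scope group_scope.

Section FreeInverseMonoidTheory.
Variable B : choiceType.
Implicit Types (x y : FIM B) (u v : word B).

Lemma fim_pi_winv u : \pi_(FIM B) (winv u) = (\pi_(FIM B) u)^-1.
Proof. by symmetry; exact: fim_inv_pi. Qed.

Lemma fim_pi_cat u v : \pi_(FIM B) (u ++ v) = \pi_(FIM B) u * \pi_(FIM B) v.
Proof. by symmetry; exact: presented_piM. Qed.

Lemma fim_mulVK x : x * x^-1 * x = x.
Proof.
elim/quotW: x => u.
have /presentedP := cong_base (fim_regular u).
by rewrite !fim_pi_cat fim_pi_winv mulgA.
Qed.

Lemma fim_mulVC x y : x * x^-1 * (y * y^-1) = y * y^-1 * (x * x^-1).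
Proof.
elim/quotW: x => u; elim/quotW: y => v.
have /presentedP := cong_base (fim_commute u v).
by rewrite !fim_pi_cat !fim_pi_winv !mulgA.
Qed.

(** The idempotents [x^-1 * x] and [y * y^-1] commute, which brings [x * x^-1 * x] together. *)
Lemma fim_mulVCl x y : x * y * (x * y)^-1 * x = x * y * y^-1.
Proof.
have xVx : x^-1 * x * (y * y^-1) = y * y^-1 * (x^-1 * x).
  by have := fim_mulVC x^-1 y; rewrite invgK.
have -> : (x * y)^-1 = y^-1 * x^-1 by exact: fim_invM.
have -> : x * y * (y^-1 * x^-1) * x = x * (y * y^-1 * (x^-1 * x)).
  by rewrite !mulgA.
by rewrite -xVx !mulgA fim_mulVK.
Qed.

(** In the natural order, the idempotent of a product lies below that of its left factor. This
    supplies the hypothesis of [fim_push]. *)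
Lemma fim_mulV_absorb x y : x * y * (x * y)^-1 * (x * x^-1) = x * y * (x * y)^-1.
Proof.
rewrite mulgA fim_mulVCl.
have -> : (x * y)^-1 = y^-1 * x^-1 by exact: fim_invM.
by rewrite !mulgA.
Qed.

End FreeInverseMonoidTheory.

Lemma rho_sigma (B : choiceType) (u v : word B) : rho u v -> sigma u v.
Proof.
elim=> [_ _ [{}u|{}u {}v]|{}u|{}u {}v _|{}u {}v w _ uv _
  |{}u u' {}v v' _ uu' _ vv'].
- rewrite -[X in sigma _ X]cats0; apply: cong_cat; first exact: cong_refl.
  by rewrite -{2}[u]winvK; apply: sigma_cancel.
- have cancel2 (x y : word B) : sigma (x ++ winv x ++ y ++ winv y) [::].
    by rewrite catA; apply: (cong_cat (sigma_cancel x) (sigma_cancel y)).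
  exact: cong_trans (cancel2 u v) (cong_sym (cancel2 v u)).
- exact: cong_refl.
- exact: cong_sym.
- exact: cong_trans.
- exact: cong_cat.
Qed.

Section FreeReduction.
Variable B : choiceType.
Implicit Types (x : letter B) (s u v : word B).

(** Left multiplication by a letter on freely reduced words, so that [foldr push [::] u] is the free
    reduction of [u]. *)
Definition push x s : word B :=
  if s is y :: s' then if y == linv x then s' else x :: s else [:: x].

Definition reduced s := sorted (fun x y => y != linv x) s.

Lemma push_reduced x s : reduced s -> reduced (push x s).
Proof.
case: s => //= y s; case: ifPn => [_|yx /=]; first exact: path_sorted.
by rewrite yx.
Qed.

(** If [s] starts with [x], the inner [push] removes that letter and the outer one restores it: as
    [s] is reduced, the next letter is not [linv x]. *)
Lemma push_linvK x s : reduced s -> push x (push (linv x) s) = s.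
Proof.
case: s => [|y s] /=; first by rewrite eqxx.
rewrite linvK; case: eqP => [->|_] /=; last by rewrite eqxx.
by case: s => //= z s /andP[/negPf -> _].
Qed.

Lemma foldr_push_reduced u s : reduced s -> reduced (foldr push s u).
Proof. by move=> sr; elim: u => //= x u; apply: push_reduced. Qed.

(** Van der Waerden's argument: by [push_linvK] each pair [x], [linv x] acts trivially, so the free
    group acts on reduced words. The start [s] stays arbitrary for the concatenation case. *)
Lemma sigma_foldr_push u v s :
  sigma u v -> reduced s -> foldr push s u = foldr push s v.
Proof.
move=> uv; elim: uv s => [{}u {}v [x]|//|{}u {}v _ IH|{}u {}v w _ IHu _ IHv
  |{}u u' {}v v' _ IHu _ IHv] s sr.
- exact: push_linvK.
- by rewrite IH.
- by rewrite IHu // IHv.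
- by rewrite !foldr_cat IHv // IHu //; apply: foldr_push_reduced.
Qed.

(** Only cancellation needs the hypothesis: there [e] absorbs the deleted pair [x], [linv x]. *)
Lemma fim_push x s (e : FIM B) :
  e * (\pi_(FIM B) [:: x] * (\pi_(FIM B) [:: x])^-1) = e ->
  e * (\pi_(FIM B) [:: x] * \pi_(FIM B) s) = e * \pi_(FIM B) (push x s).
Proof.
rewrite -(fim_pi_cat [:: x] s); case: s => //= y s; case: eqP => // -> eK.
rewrite -[in RHS]eK -[_ :: _]/([:: x] ++ winv [:: x] ++ s) !fim_pi_cat.
by rewrite fim_pi_winv !mulgA.
Qed.

Lemma fim_reduction u :
  \pi_(FIM B) u
  = \pi_(FIM B) u * (\pi_(FIM B) u)^-1 * \pi_(FIM B) (foldr push [::] u).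
Proof.
elim: u => [|x u IHu] /=; first by rewrite -fim_pi_winv !mulg1.
(* Here [e] is the idempotent of the whole word [x :: u]. Multiplied by [x] it becomes [x] times the
   idempotent of [u], where the induction hypothesis applies. *)
rewrite -cat1s fim_pi_cat -fim_push; last exact: fim_mulV_absorb.
by rewrite [RHS]mulgA fim_mulVCl {1}IHu !mulgA.
Qed.

(* [FIM B] is E-unitary. *)
Lemma fim_idempotent_sigma u :
  \pi_(FIM B) u * \pi_(FIM B) u = \pi_(FIM B) u <-> sigma u [::].
Proof.
split=> [|u1].
  rewrite -fim_pi_cat => /presentedP/rho_sigma.
  move/(presentedP (@fg_rel B)); rewrite -presented_piM => uu.
  (* Cancellation in [FG B]: an idempotent of a group is the identity. *)
  by apply/presentedP/(@mulgI (FG B) (\pi_(FG B) u)); rewrite [RHS]mulg1.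
have uE : \pi_(FIM B) u = \pi_(FIM B) u * (\pi_(FIM B) u)^-1.
  by rewrite {1}fim_reduction (sigma_foldr_push u1) //= mulg1.
by rewrite {1}uE fim_mulVK.
Qed.

End FreeReduction.

Theorem proposition4p17 (A : finType) (w : word A) :
  Kcong (mker (@eraser A)) (\pi_(FIM A) w) <-> fragile (\pi_(FG A) w).
Proof.
rewrite [X in X <-> _](_ : _ = (eraser (\pi_(FIM A) w)
                                = eraser (\pi_(FIM A) (w ++ w)))); last first.
  by rewrite fim_pi_cat.
(* Idempotency in the product is checked at each coordinate [a], on the word [erase a w]. *)
rewrite !eraser_pi; split=> [/ffunP wE a|wf].
  rewrite fg_erase_pi; apply/presentedP/fim_idempotent_sigma.
  by have := wE a; rewrite !ffunE erase_cat fim_pi_cat.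
apply/ffunP => a; rewrite !ffunE erase_cat fim_pi_cat; apply/esym.
by apply/fim_idempotent_sigma/presentedP; rewrite -fg_erase_pi; apply: wf.
Qed.
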